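(* There exists an absolute constant $C>0$ such that the following holds for every integer $n\ge 2$. Let $\mathcal{S}$ be a family of $n$ curves in the plane, each colored red or blue, such that every curve is $x$-monotone and no two curves of the same color intersect. Then the number of tangencies between curves of $\mathcal{S}$ is at most $C\, n\log n$.
   Context: A curve is a simple planar curve (Jordan arc), i.e., the image of an injective continuous map from an (open or closed) interval into the plane. A curve is $x$-monotone if every vertical line meets it in at most one point. It is assumed that any two curves intersect in finitely many points and that no three curves pass through a common point. An intersection point $p$ of two curves is a crossing point if there is a Jordan region $D$ containing $p$ but no other intersection point of the two curves in its interior, such that each curve meets the boundary of $D$ in exactly two points and in the cyclic order of these four points no two consecutive points belong to the same curve. Two curves touch at a tangency point $p$ if both contain $p$ in their relative interior, $p$ is their only intersection point, and $p$ is not a crossing point. The number of tangencies is the number of such tangency points (equivalently, of touching pairs of curves). *)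

(* Defs.v *)
From HB Require Import structures.
From mathcomp Require Import all_boot all_order all_algebra.
From mathcomp Require Import all_classical all_reals all_analysis.
Import numFieldNormedType.Exports.
Set Implicit Arguments. Unset Strict Implicit. Unset Printing Implicit Defensive.
Import Order.TTheory GRing.Theory Num.Theory.
Local Open Scope classical_set_scope.
Local Open Scope ring_scope.

Section Curves.
Variable R : realType.
Notation pt := (R * R)%type.

Definition curve_domain (I : set R) : Prop :=
  (exists a b : R, a < b /\ I = [set t | a <= t <= b]) \/
  (exists a b : \bar R, (a < b)%E /\ I = [set t | (a < t%:E < b)%E]).

Definition is_curve (I : set R) (gam : R -> pt) : Prop :=
  curve_domain I /\ {within I, continuous gam} /\
  (forall s t, I s -> I t -> gam s = gam t -> s = t).

Definition curve_set (I : set R) (gam : R -> pt) : set pt := gam @` I.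
Definition curve_relint (I : set R) (gam : R -> pt) : set pt :=
  gam @` (interior I).

Definition x_monotone (C : set pt) : Prop :=
  forall p q, C p -> C q -> p.1 = q.1 -> p = q.

Definition closed_disk : set pt := [set u | u.1 ^+ 2 + u.2 ^+ 2 <= 1].
Definition open_disk : set pt := [set u | u.1 ^+ 2 + u.2 ^+ 2 < 1].
Definition unit_circle : set pt := [set u | u.1 ^+ 2 + u.2 ^+ 2 = 1].

Definition cross (u v : pt) : R := u.1 * v.2 - u.2 * v.1.
Definition psub (u v : pt) : pt := (u.1 - v.1, u.2 - v.2).

(* u1,u2,v1,v2 on the unit circle alternate in cyclic order iff the chord
   u1u2 strictly separates v1 from v2. *)
Definition alternate (u1 u2 v1 v2 : pt) : Prop :=
  cross (psub u2 u1) (psub v1 u1) * cross (psub u2 u1) (psub v2 u1) < 0.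

(* A Jordan region is given as the image D = h(closed disk) of a topological
   embedding h of the closed unit disk; its interior is h(open disk) and its
   boundary is h(unit circle). *)
Definition disk_embedding (h : pt -> pt) : Prop :=
  {within closed_disk, continuous h} /\
  (forall u v, closed_disk u -> closed_disk v -> h u = h v -> u = v).

Definition crossing_point (C1 C2 : set pt) (p : pt) : Prop :=
  C1 p /\ C2 p /\
  exists h : pt -> pt, disk_embedding h /\
    (h @` open_disk) p /\
    (forall q, C1 q -> C2 q -> (h @` open_disk) q -> q = p) /\
    exists u1 u2 v1 v2 : pt,
      [/\ unit_circle u1, unit_circle u2, unit_circle v1 & unit_circle v2] /\
      u1 != u2 /\ v1 != v2 /\
      C1 `&` (h @` unit_circle) = [set h u1; h u2] /\
      C2 `&` (h @` unit_circle) = [set h v1; h v2] /\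
      alternate u1 u2 v1 v2.

Definition touch_at (I1 : set R) (g1 : R -> pt) (I2 : set R) (g2 : R -> pt)
  (p : pt) : Prop :=
  curve_relint I1 g1 p /\ curve_relint I2 g2 p /\
  curve_set I1 g1 `&` curve_set I2 g2 = [set p] /\
  ~ crossing_point (curve_set I1 g1) (curve_set I2 g2) p.

Definition touching (I1 : set R) (g1 : R -> pt) (I2 : set R) (g2 : R -> pt)
  : Prop := exists p, touch_at I1 g1 I2 g2 p.

Definition curve_family (n : nat) (I : 'I_n -> set R) (g : 'I_n -> R -> pt)
  : Prop :=
  (forall i, is_curve (I i) (g i)) /\
  (forall i j, i != j -> finite_set (curve_set (I i) (g i) `&` curve_set (I j) (g j))) /\
  (forall i j k p, i != j -> j != k -> i != k ->
     ~ [/\ curve_set (I i) (g i) p, curve_set (I j) (g j) p & curve_set (I k) (g k) p]).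

Definition num_tangencies (n : nat) (I : 'I_n -> set R) (g : 'I_n -> R -> pt)
  : nat :=
  #|[set ij : 'I_n * 'I_n | ((ij.1 < ij.2)%N &&
       `[< touching (I ij.1) (g ij.1) (I ij.2) (g ij.2) >])]|.

End Curves.

(* Main.v *)
(* An x-monotone curve is the graph of a continuous function over an interval
   J. If two graphs touch, their difference has constant sign on the common
   part of the two intervals: otherwise a disk that straightens one of the
   curves exhibits a crossing point. Hence, over an interval of abscissae
   covered by two curves c and c' of the same color, a curve d cannot touch
   both from the same side, by the intermediate value theorem.
   Rank the abscissae by the at most 2n endpoints below them and cut the line
   into the cells of the dyadic partitions of the ranks. For a tangency of
   abscissa x take the largest scale k at which one of the two curves, c,
   covers the cell of x, and charge the tangency to the other curve d. At
   scale k + 1 the curve d has an endpoint in the cell of x (unless k is the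
   top scale, which has a single cell), so for given d and k there are at most
   four cells, and in each cell at most one curve c on each side of d. With
   O(log n) scales this gives O(n log n). *)
Require Import Defs.
From HB Require Import structures.
From mathcomp Require Import all_boot all_order all_algebra.
From mathcomp Require Import all_classical all_reals all_analysis.
From mathcomp Require Import ring lra zify.
Import Order.TTheory GRing.Theory Num.Theory numFieldNormedType.Exports.
Local Open Scope classical_set_scope.
Local Open Scope ring_scope.

(** * Continuity on subsets and extension from a segment *)

Lemma within_continuous_comp_sub {T U V : topologicalType} (A : set T) (B : set U)
    (f : T -> U) (g : U -> V) :
  {within A, continuous f} -> {within B, continuous g} -> f @` A `<=` B ->
  {within A, continuous (g \o f)}.
Proof.
move=> /subspace_continuousP cf /subspace_continuousP cg fAB.
apply/subspace_continuousP => x Ax W nW.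
have Bfx : B (f x) by apply: fAB; exists x.
have : within A (nbhs x) (f @^-1` (fun u => B u -> W (g u))).
  exact: cf x Ax _ (cg _ Bfx W nW).
rewrite /within /=; change (nbhs x (fun y => A y -> B (f y) -> W (g (f y))) ->
  nbhs x (fun y => A y -> W (g (f y)))).
by apply: filterS => y /= H Ay; apply: H => //; apply: fAB; exists y.
Qed.

Definition clamp {R : realType} (a b x : R) : R := Num.max a (Num.min x b).

Lemma clamp_continuous {R : realType} (a b : R) : continuous (clamp a b).
Proof.
move=> x; apply: (@continuous_max _ _ (cst a) (fun x => Num.min x b)).
  exact: cst_continuous.
apply: (@continuous_min _ _ id (cst b)); first by move=> ?; exact: cvg_id.
exact: cst_continuous.
Qed.

Lemma clamp_itv {R : realType} (a b x : R) : a <= b -> clamp a b x \in `[a, b].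
Proof.
by move=> ab; rewrite in_itv /= /clamp le_max lexx ge_max ab ge_min lexx orbT.
Qed.

Lemma clamp_id {R : realType} (a b x : R) : x \in `[a, b] -> clamp a b x = x.
Proof.
by rewrite in_itv /= /clamp => /andP[ax xb]; rewrite (min_idPl xb) (max_idPr ax).
Qed.

Lemma continuous_clamp_ext {R : realType} (a b : R) (f : R -> R) : a <= b ->
  {within `[a, b], continuous f} -> continuous (f \o clamp a b).
Proof.
move=> ab cf; apply/continuous_subspace_setT.
apply: (@within_continuous_comp_sub _ _ _ setT `[a, b]%classic) cf _.
  exact/continuous_subspaceT/clamp_continuous.
by move=> _ [x _ <-] /=; exact: clamp_itv.
Qed.

(** * x-monotone curves as graphs over intervals *)

Definition graph_over {R : realType} (J : set R) (f : R -> R) : set (R * R) :=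
  [set p | J p.1 /\ p.2 = f p.1].

(** The extension to the whole line lets later arguments use plain continuity. Only compact segments
    are considered, since [f] may blow up at an open end of [J]. *)
Definition segment_continuous {R : realType} (J : set R) (f : R -> R) :=
  forall a b, J a -> J b -> a <= b ->
  exists2 F : R -> R, continuous F & {in `[a, b], F =1 f}.

Lemma curve_domain_is_interval {R : realType} (I : set R) :
  curve_domain I -> is_interval I.
Proof.
case=> [[a [b [_ ->]]]|[a [b [_ ->]]]] x y /= /andP[ax xb] /andP[ay yb] z /andP[xz zy].
  by rewrite (le_trans ax) //= (le_trans zy).
by rewrite (lt_le_trans ax) ?lee_fin //= (le_lt_trans _ yb) ?lee_fin.
Qed.

Lemma between_injective_image {R : realType} (f : R -> R) (l t r : R) : l < t < r ->
  {within `[l, r], continuous f} -> {in `[l, r] &, injective f} ->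
  f l < f t < f r \/ f r < f t < f l.
Proof.
move=> /andP[lt tr] cf fi; have lr := lt_trans lt tr.
have lI : l \in `[l, r] by rewrite in_itv /= lexx ltW.
have tI : t \in `[l, r] by rewrite in_itv /= !ltW.
have rI : r \in `[l, r] by rewrite in_itv /= lexx ltW.
have [m|m] := itv_continuous_inj_mono cf fi; [left|right].
  by rewrite !m // lt tr.
by rewrite !m // lt tr.
Qed.

(** By x-monotonicity the abscissa [phi] is injective on [I]. [J] is its image, and [f] is the
    ordinate at the parameter [psi x], with [psi] the inverse of [phi]. *)
Lemma x_monotone_graph {R : realType} (I : set R) (g : R -> R * R) :
  is_curve I g -> x_monotone (curve_set I g) ->
  exists (J : set R) (f : R -> R),
    [/\ is_interval J, segment_continuous J f, curve_set I g = graph_over J f &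
        forall p, curve_relint I g p -> exists a b, [/\ J a, J b & a < p.1 < b]].
Proof.
move=> [Idom [gc ginj]] mono.
have Iitv := curve_domain_is_interval _ Idom.
pose phi t := (g t).1.
have phi_inj s t : I s -> I t -> phi s = phi t -> s = t.
  by move=> Is It e; apply: ginj => //; apply: mono => //; [exists s|exists t].
have phic : {within I, continuous phi}.
  apply: (@within_continuous_comp_sub _ _ _ I setT g fst gc) => //.
  by apply: continuous_subspaceT => x; exact: cvg_fst.
have sndc : {within I, continuous (fun t => (g t).2)}.
  apply: (@within_continuous_comp_sub _ _ _ I setT g snd gc) => //.
  by apply: continuous_subspaceT => x; exact: cvg_snd.
pose J := phi @` I.
have /choice[psi psiP] : forall x, exists t, J x -> I t /\ phi t = x.
  move=> x; have [[t It <-]|nJ] := pselect (J x); first by exists t.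
  by exists 0.
have psiK t : I t -> psi (phi t) = t.
  move=> It; have [|It' e] := psiP (phi t); first by exists t.
  exact: phi_inj.
have Isub s t : I s -> I t -> [set` `[s, t]] `<=` I.
  by move=> Is It z /=; rewrite in_itv /= => zst; exact: (Iitv s t).
have phicst s t : I s -> I t -> {within `[s, t], continuous phi}.
  by move=> Is It; apply: continuous_subspaceW phic; exact: Isub.
(* [phi] may be decreasing, so the parameters of [a] and [b] come in either order. *)
have Jseg a b : J a -> J b -> a <= b -> exists l r, [/\ I l, I r, l <= r &
     a = Num.min (phi l) (phi r) /\ b = Num.max (phi l) (phi r)].
  move=> [s Is <-] [t It <-] ab; have [st|/ltW ts] := leP s t.
    by exists s, t; rewrite (min_idPl ab) (max_idPr ab).
  by exists t, s; rewrite (min_idPr ab) (max_idPl ab).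
have img l r x : I l -> I r -> l <= r -> 
    x \in `[Num.min (phi l) (phi r), Num.max (phi l) (phi r)] ->
    exists2 c, c \in `[l, r] & phi c = x.
  by move=> Il Ir lr; rewrite in_itv /=; apply: IVT lr (phicst _ _ Il Ir).
have Jitv : is_interval J.
  move=> a b Ja Jb z zab; have ab : a <= b by case/andP: zab => /le_trans; exact.
  have [l [r [Il Ir lr [ea eb]]]] := Jseg a b Ja Jb ab.
  have [||||c cI e] // := img l r z; first by rewrite -ea -eb in_itv.
  by exists c => //; exact: Isub cI.
exists J, (fun x => (g (psi x)).2); split => //.
- move=> a b Ja Jb ab.
  exists ((fun x => (g (psi x)).2) \o clamp a b); last first.
    by move=> x xab /=; rewrite clamp_id.
  apply: continuous_clamp_ext => //.
  have [l [r [Il Ir lr [ea eb]]]] := Jseg a b Ja Jb ab.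
  (* A continuous injection of a segment has a continuous inverse. *)
  have psic : {within `[a, b], continuous psi}.
    rewrite ea eb; apply: segment_can_continuous => //; first exact: phicst.
    by move=> t tI; apply: psiK; exact: Isub tI.
  apply: (@within_continuous_comp_sub _ _ _ `[a, b]%classic I psi (fun t => (g t).2)) => //.
  move=> _ [x /= xab <-]; have [||||c cI <-] // := img l r x.
    by rewrite -ea -eb.
  by rewrite psiK; exact: Isub cI.
- apply/seteqP; split=> [_ [t It <-]|[x y] [/= Jx /= ->]].
    by split=> /=; [exists t|rewrite psiK].
  have [It e] := psiP x Jx; exists (psi x) => //.
  by rewrite [LHS]surjective_pairing -[(g _).1]/(phi (psi x)) e.
- move=> _ [t /nbhs_ballP[e /= e0 eI] <-].
  have dI d : `|d| < e -> I (t + d).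
    by move=> de; apply: eI; rewrite /ball /= opprD addrA subrr add0r normrN.
  have e2 : `|e / 2| < e by rewrite ger0_norm; lra.
  have Il : I (t - e / 2) by apply: dI; rewrite normrN.
  have Ir : I (t + e / 2) by exact: dI.
  have It : I t by rewrite -[t]addr0; apply: dI; rewrite normr0.
  have [||s s' sI s'I|h|h] :=
      between_injective_image phi (t - e / 2) t (t + e / 2).
  - lra.
  - exact: phicst.
  - by apply: phi_inj; [exact: Isub sI|exact: Isub s'I].
  - exists (phi (t - e / 2)), (phi (t + e / 2)).
    by split; [exists (t - e / 2)|exists (t + e / 2)|].
  - exists (phi (t + e / 2)), (phi (t - e / 2)).
    by split; [exists (t + e / 2)|exists (t - e / 2)|].
Qed.

(** * A sign change produces a crossing point *)

Lemma nonvanishing_same_sign {R : realType} (D : R -> R) (c e : R) : c <= e ->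
  continuous D -> (forall x, c <= x <= e -> D x != 0) -> 0 < D c * D e.
Proof.
move=> ce cD nz; rewrite ltNge; apply/negP => H.
have [|x] := @IVT _ D c e 0 ce (continuous_subspaceT cD).
  by rewrite ge_min le_max; case: (leP (D c) 0); case: (leP 0 (D e)) => /=; nra.
by rewrite in_itv /= => /nz /eqP.
Qed.

(** The disk is [h (u, v) = (psi u, F1 (psi u) + k u * v)]. It sends the horizontal diameter into
    the first graph, and in its coordinates the second graph is [v = d u / k u]. The scale [k] makes
    the latter meet the circle in exactly two points, on opposite sides of the diameter. *)
Lemma sign_change_crossing {R : realType} (J1 J2 : set R) (f1 f2 : R -> R)
    (a b : R) (p : R * R) :
  is_interval J1 -> segment_continuous J1 f1 ->
  is_interval J2 -> segment_continuous J2 f2 ->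
  J1 a -> J1 b -> J2 a -> J2 b -> a < p.1 < b ->
  graph_over J1 f1 `&` graph_over J2 f2 = [set p] ->
  (f2 a - f1 a) * (f2 b - f1 b) < 0 ->
  crossing_point (graph_over J1 f1) (graph_over J2 f2) p.
Proof.
move=> I1 c1 I2 c2 J1a J1b J2a J2b /andP[ap pb] capE sgn.
have [[J1p p1] [J2p p2]] : (graph_over J1 f1 `&` graph_over J2 f2) p by rewrite capE.
have ab := lt_trans ap pb.
have [F1 cF1 F1E] := c1 a b J1a J1b (ltW ab).
have [F2 cF2 F2E] := c2 a b J2a J2b (ltW ab).
pose x0 := p.1; pose D x := F2 x - F1 x.
have cD : continuous D by move=> x; apply: cvgB; [exact: cF2|exact: cF1].
have abJ1 x : x \in `[a, b] -> J1 x by rewrite in_itv /= => /I1; apply.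
have abJ2 x : x \in `[a, b] -> J2 x by rewrite in_itv /= => /I2; apply.
have D0 x : x \in `[a, b] -> D x = 0 -> x = x0.
  move=> xab /eqP; rewrite subr_eq0 F1E // F2E // => /eqP e.
  have : (graph_over J1 f1 `&` graph_over J2 f2) (x, f1 x).
    by split; split => //=; [exact: abJ1|exact: abJ2].
  by rewrite capE => /= ep; rewrite /x0 -ep.
have Dx0 : D x0 = 0.
  by rewrite /D F1E ?F2E -?p1 -?p2 ?subrr // in_itv /= !ltW.
(* [psi] will map [[-1, 1]] onto the largest interval centred at [x0] inside [[a, b]]. *)
pose del : R := Num.min (x0 - a) (b - x0).
have del0 : 0 < del by rewrite lt_min !subr_gt0 ap pb.
have dela : del <= x0 - a by rewrite ge_min lexx.
have delb : del <= b - x0 by rewrite ge_min lexx orbT.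
clearbody del; pose psi (u : R) := x0 + del * u.
have psiI (u : R) : -1 <= u <= 1 -> psi u \in `[a, b].
  move=> /andP[u1 u2]; rewrite in_itv /= /psi.
  have h1 : 0 <= del * (u + 1) by apply: mulr_ge0; lra.
  have h2 : 0 <= del * (1 - u) by apply: mulr_ge0; lra.
  by apply/andP; split; nra.
have psi_inj u v : psi u = psi v -> u = v.
  by move=> /addrI /mulfI; apply; rewrite gt_eqF.
pose d (u : R) := D (psi u).
have d0 (u : R) : -1 <= u <= 1 -> d u = 0 -> u = 0.
  by move=> u1 du; apply: psi_inj; rewrite (D0 _ (psiI _ u1) du) /psi; ring.
(* [D] vanishes only at [x0], so it keeps its sign from [a] to [psi (- (4 / 5))] and from
   [psi (4 / 5)] to [b]. *)
have dsgn : d (- (4 / 5)) * d (4 / 5) < 0.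
  have h1 : 0 < D a * d (- (4 / 5)).
    apply: (nonvanishing_same_sign D) => //; first by rewrite /psi; lra.
    move=> x /andP[ax xp]; apply/eqP => Dx.
    have xx0 : x < x0 by rewrite (le_lt_trans xp) // /psi; lra.
    have : x = x0 by apply: D0 => //; rewrite in_itv /= ax ltW // (lt_trans xx0).
    by lra.
  have h2 : 0 < d (4 / 5) * D b.
    apply: (nonvanishing_same_sign D) => //; first by rewrite /psi; lra.
    move=> x /andP[px xb]; apply/eqP => Dx.
    have xx0 : x0 < x by rewrite (lt_le_trans _ px) // /psi; lra.
    have : x = x0 by apply: D0 => //; rewrite in_itv /= xb ltW // (lt_trans ap).
    by lra.
  have : D a * D b < 0.
    by rewrite /D !F1E ?F2E // in_itv /= lexx ltW.
  move: h1 h2; generalize (D a) (D b) (d (- (4/5))) (d (4/5)) => A B x y h1 h2 h.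
  have h3 : 0 < (A * x) * (y * B) by exact: mulr_gt0.
  rewrite ltNge; apply/negP => xy.
  have : (A * B) * (x * y) <= 0 by rewrite mulr_le0_ge0 // ltW.
  by rewrite leNgt => /negP; apply; nra.
(* With this vertical scale the second curve is [v = ± 3/5] for [|u| >= 1/2],
   so that it leaves the disk exactly at [u = ± 4/5]. *)
pose k (u : R) := 5 / 3 * `|d u| + Num.max 0 (1 / 2 - `|u|).
(* Positivity makes [h] injective. At [u = 0] it comes from the second summand, elsewhere from the
   first. *)
have k_gt0 (u : R) : -1 <= u <= 1 -> 0 < k u.
  move=> u1; rewrite /k; have [u0|u0] := eqVneq u 0.
    by rewrite u0 normr0 subr0 ltr_wpDl ?mulr_ge0 // lt_max; apply/orP; right; lra.
  rewrite ltr_pwDl ?le_max ?lexx // mulr_gt0 // normr_gt0.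
  by apply: contra_neq u0; exact: d0.
have k_ge (u : R) : 5 / 3 * `|d u| <= k u by rewrite lerDl le_max lexx.
have kE (u : R) : 1 / 2 <= `|u| -> k u = 5 / 3 * `|d u|.
  by move=> u1; rewrite /k (max_idPl _) ?addr0 // subr_le0.
pose h (w : R * R) := (psi w.1, F1 (psi w.1) + k w.1 * w.2).
have diskI (w : R * R) : closed_disk w -> -1 <= w.1 <= 1.
  by rewrite /closed_disk /= => ?; nra.
have circI (w : R * R) : unit_circle w -> -1 <= w.1 <= 1.
  by rewrite /unit_circle /= => ?; nra.
have cpsi : continuous psi.
  by move=> u; apply: cvgD; [exact: cvg_cst|apply: cvgM; [exact: cvg_cst|exact: cvg_id]].
have cd : continuous d by move=> u; exact: (continuous_comp (cpsi u) (cD _)).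
have ck : continuous k.
  move=> u; apply: cvgD.
    apply: cvgM; first exact: cvg_cst.
    by apply: cvg_norm; exact: cd.
  apply: (@continuous_max _ _ (cst 0) (fun u => 1 / 2 - `|u|)).
    exact: cst_continuous.
  by apply: cvgB; [exact: cvg_cst|exact: norm_continuous].
have cfst : continuous (fun z : R * R => z.1) by move=> w; exact: cvg_fst.
have ch : continuous h.
  move=> w.
  have c1' : (fun z : R * R => psi z.1) @ w --> psi w.1.
    exact: (continuous_comp (cfst w) (cpsi _)).
  have c2' : (fun z : R * R => F1 (psi z.1) + k z.1 * z.2) @ w -->
      F1 (psi w.1) + k w.1 * w.2.
    apply: cvgD; first exact: (continuous_comp c1' (cF1 _)).
    by apply: cvgM; [exact: (continuous_comp (cfst w) (ck _))|exact: cvg_snd].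
  exact: cvg_pair c1' c2'.
have hC1 (w : R * R) : -1 <= w.1 <= 1 -> graph_over J1 f1 (h w) <-> w.2 = 0.
  move=> w1; rewrite /graph_over /= -F1E ?psiI //; split=> [[_]|->].
    move/eqP; rewrite -subr_eq0 addrAC subrr add0r mulf_eq0 gt_eqF ?k_gt0 //=.
    by move/eqP.
  by rewrite mulr0 addr0; split=> //; exact/abJ1/psiI.
have hC2 (w : R * R) : -1 <= w.1 <= 1 -> graph_over J2 f2 (h w) <-> k w.1 * w.2 = d w.1.
  move=> w1; rewrite /graph_over /= -F2E ?psiI // /d /D; split=> [[_ <-]|->].
    by rewrite addrAC subrr add0r.
  by split; [exact/abJ2/psiI|ring].
pose v1 : R * R := (- (4 / 5), d (- (4 / 5)) / k (- (4 / 5))).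
pose v2 : R * R := (4 / 5, d (4 / 5) / k (4 / 5)).
have circ45 (u : R) : `|u| = 4 / 5 -> -1 <= u <= 1 /\ unit_circle (u, d u / k u).
  move=> u45; have u1 : -1 <= u <= 1 by rewrite -ler_norml u45; lra.
  split => //; rewrite /unit_circle /= -[u ^+ 2]real_normK ?num_real // u45.
  rewrite -[(d u / k u) ^+ 2]real_normK ?num_real // normrM normfV.
  rewrite (gtr0_norm (k_gt0 _ u1)) kE ?u45; last by lra.
  have : `|d u| != 0.
    rewrite normr_eq0; apply/eqP => /(d0 _ u1) u0; move: u45.
    by rewrite u0 normr0; lra.
  by move=> dn0; field.
have n45 : `|4 / 5 : R| = 4 / 5 by rewrite ger0_norm //; lra.
have [v2I v2C] := circ45 _ n45.
have [v1I v1C] : -1 <= - (4 / 5 : R) <= 1 /\ unit_circle v1.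
  by apply: circ45; rewrite normrN.
split; first by [].
split; first by [].
exists h; split; [split|split; [|split]].
- exact: continuous_subspaceT.
- move=> [u v] [u' v'] /diskI /= u1 _ [/psi_inj uu']; rewrite -uu' => /addrI.
  by move=> /mulfI -> //; rewrite gt_eqF // k_gt0.
- exists (0, 0); first by rewrite /open_disk /=; lra.
  rewrite /h /= /psi mulr0 !addr0 F1E ?in_itv /= ?ltW // mulr0 addr0 -p1.
  by rewrite -surjective_pairing.
- by move=> q q1 q2 _; have : (graph_over J1 f1 `&` graph_over J2 f2) q by []; rewrite capE.
exists (-1, 0), (1, 0), v1, v2; split.
  by split=> //; rewrite /unit_circle /=; ring.
split; first by rewrite xpair_eqE negb_and; apply/orP; left; apply/eqP; lra.
split; first by rewrite xpair_eqE negb_and; apply/orP; left; apply/eqP; lra.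
split; [|split].
- apply/seteqP; split=> [q [C1q [w wC wq]]|q].
    have w20 : w.2 = 0 by apply: (proj1 (hC1 w (circI w wC))); rewrite wq.
    rewrite -wq; move: wC; rewrite /unit_circle /= w20 expr0n addr0 => /eqP.
    by rewrite sqrf_eq1 => /orP[]/eqP w1; [right|left];
      rewrite [w]surjective_pairing w1 w20.
  have C1h (w : R * R) : unit_circle w -> w.2 = 0 ->
      (graph_over J1 f1 `&` (h @` @unit_circle R)) (h w).
    by move=> wC e; split; [exact: (proj2 (hC1 w (circI w wC)))|exists w].
  by move=> [] ->; apply: C1h => //; rewrite /unit_circle /=; ring.
- apply/seteqP; split=> [q [C2q [w wC wq]]|q].
    have w1 := circI _ wC; have e : k w.1 * w.2 = d w.1.
      by apply: (proj1 (hC2 w w1)); rewrite wq.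
    rewrite -wq {q C2q wq}.
    have kw := k_gt0 _ w1.
    have e2 : w.2 = d w.1 / k w.1 by rewrite -e mulrC mulrA mulVf ?mul1r ?gt_eqF.
    have n2 : k w.1 * `|w.2| = `|d w.1| by rewrite -e normrM (gtr0_norm kw).
    have sq : `|w.1| ^+ 2 + `|w.2| ^+ 2 = 1 by rewrite !real_normK ?num_real.
    have nz : w.1 != 0 -> 0 < `|d w.1|.
      by rewrite normr_gt0 => u0; apply: contra_neq u0; exact: d0.
    have [w12|w12] := leP (1 / 2) `|w.1|.
      have dw : 0 < `|d w.1|.
        by apply: nz; rewrite -normr_gt0; lra.
      have w35 : `|w.2| = 3 / 5.
        have : `|d w.1| * (5 / 3 * `|w.2|) = `|d w.1| * 1.
          by rewrite mulr1 -[RHS]n2 kE //; ring.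
        by move=> /mulfI -/(_ (lt0r_neq0 dw)); lra.
      have /eqP : `|w.1| = 4 / 5 by have := normr_ge0 w.1; move: sq; rewrite w35; nra.
      rewrite eqr_norml => /andP[/orP[]/eqP w1E _]; [right|left];
        by rewrite [w]surjective_pairing e2 w1E.
    (* For [0 < |w.1| < 1/2] still [|w.2| <= 3/5], and [1/4 + 9/25 < 1]; at [w.1 = 0] the ordinate
       is [0]. *)
    exfalso; have [w0|/nz dw] := eqVneq w.1 0.
      have dw0 : d w.1 = 0 by rewrite w0 /d /psi mulr0 addr0.
      by move: sq; rewrite e2 dw0 w0 mul0r !normr0; lra.
    have : `|w.2| <= 3 / 5.
      have : 5 / 3 * `|d w.1| * `|w.2| <= `|d w.1| by rewrite -{2}n2 ler_wpM2r.
      by nra.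
    by have := normr_ge0 w.2; have := normr_ge0 w.1; nra.
  have C2h (w : R * R) : unit_circle w -> k w.1 * w.2 = d w.1 ->
      (graph_over J2 f2 `&` (h @` @unit_circle R)) (h w).
    by move=> wC e; split; [exact: (proj2 (hC2 w (circI w wC)))|exists w].
  by move=> [] ->; apply: C2h => //=; rewrite mulrC divfK // gt_eqF // k_gt0.
- rewrite /alternate /cross /psub /=.
  have k1 := k_gt0 _ v1I; have k2 := k_gt0 _ v2I.
  (* Along the horizontal diameter each cross product is twice the ordinate of [v1] or [v2]. *)
  rewrite [X in X < 0](_ : _ = 4 * (d (- (4 / 5)) * d (4 / 5) / (k (- (4 / 5)) * k (4 / 5)))).
    by rewrite pmulr_rlt0 // pmulr_llt0 // invr_gt0 mulr_gt0.
  by field; rewrite !gt_eqF.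
Qed.

(** * Touching from one side *)

(** [s = false] puts [c] weakly above [d] on all common abscissae, [s = true] weakly below. *)
Definition touches_from {R : realType} (s : bool) (Jc : set R) (fc : R -> R)
    (Jd : set R) (fd : R -> R) (x : R) :=
  [/\ Jc x, Jd x, fc x = fd x &
      forall y, Jc y -> Jd y -> 0 <= (-1) ^+ s * (fc y - fd y)].

Lemma touches_from_sym {R : realType} s (Jc : set R) fc Jd fd x :
  touches_from s Jc fc Jd fd x -> touches_from (~~ s) Jd fd Jc fc x.
Proof.
move=> [cx dx e h]; split=> // y dy cy; have := h y cy dy.
by rewrite signrN -opprB mulrN mulNr.
Qed.

(** The difference [D] vanishes at [p.1] only, and opposite signs on the two sides would give a
    crossing by [sign_change_crossing]. Two points on the same side are compared through a point on
    the other. *)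
Lemma touch_at_touches_from {R : realType} (I1 I2 : set R) (g1 g2 : R -> R * R)
    (J1 J2 : set R) (f1 f2 : R -> R) (p : R * R) :
  is_interval J1 -> segment_continuous J1 f1 ->
  is_interval J2 -> segment_continuous J2 f2 ->
  curve_set I1 g1 = graph_over J1 f1 -> curve_set I2 g2 = graph_over J2 f2 ->
  (curve_relint I1 g1 p -> exists a b, [/\ J1 a, J1 b & a < p.1 < b]) ->
  (curve_relint I2 g2 p -> exists a b, [/\ J2 a, J2 b & a < p.1 < b]) ->
  touch_at I1 g1 I2 g2 p -> exists s, touches_from s J1 f1 J2 f2 p.1.
Proof.
rewrite /touch_at => itv1 cf1 itv2 cf2 -> -> ri1 ri2 [/ri1 [a1 [b1 [Ja1 Jb1 /andP[a1p pb1]]]]].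
move=> [/ri2 [a2 [b2 [Ja2 Jb2 /andP[a2p pb2]]]] [capE ncross]].
have [[J1p p1] [J2p p2]] : (graph_over J1 f1 `&` graph_over J2 f2) p by rewrite capE.
pose a := Num.max a1 a2; pose b := Num.min b1 b2.
have ap : a < p.1 by rewrite gt_max a1p.
have pb : p.1 < b by rewrite lt_min pb1.
have J1a : J1 a by apply: (itv1 a1 p.1) => //; rewrite le_max lexx /= ltW.
have J2a : J2 a by apply: (itv2 a2 p.1) => //; rewrite le_max lexx orbT /= ltW.
have J1b : J1 b by apply: (itv1 p.1 b1) => //; rewrite ge_min lexx andbT ltW.
have J2b : J2 b by apply: (itv2 p.1 b2) => //; rewrite ge_min lexx orbT andbT ltW.
pose D x := f2 x - f1 x.
have D0 x : J1 x -> J2 x -> x != p.1 -> D x != 0.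
  move=> J1x J2x; apply: contra_neq => /eqP; rewrite subr_eq0 => /eqP e.
  have : (graph_over J1 f1 `&` graph_over J2 f2) (x, f1 x) by split; split.
  by rewrite capE => <-.
have DD l r : J1 l -> J2 l -> J1 r -> J2 r -> l < p.1 < r -> 0 < D l * D r.
  move=> J1l J2l J1r J2r lpr; rewrite lt_def mulf_neq0 /=.
  - rewrite leNgt; apply/negP => neg; apply: ncross.
    exact: (sign_change_crossing _ _ _ _ l r).
  - by apply: D0 => //; rewrite lt_eqF //; case/andP: lpr.
  - by apply: D0 => //; rewrite gt_eqF //; case/andP: lpr.
have Dab := DD a b J1a J2a J1b J2b; rewrite ap pb in Dab; have {}Dab := Dab isT.
have Dy y : J1 y -> J2 y -> 0 <= D y * D b.
  move=> J1y J2y; have [yp|py|yp] := ltgtP y p.1.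
  - by apply/ltW/DD => //; rewrite yp.
  - have Day : 0 < D a * D y by apply: DD => //; rewrite ap.
    have : 0 <= (D a * D y) * (D a * D b) by rewrite mulr_ge0 // ltW.
    rewrite mulrACA pmulr_rge0 // -expr2 exprn_even_gt0 //=.
    by apply: D0 => //; rewrite lt_eqF.
  - by rewrite /D yp -p1 -p2 subrr mul0r.
have b0 : D b != 0 by apply: D0; rewrite // gt_eqF.
exists (0 < D b); split=> //; first by rewrite -p1.
move=> y J1y J2y; have := Dy y J1y J2y; rewrite -opprB -/(D y).
have [Dbp|Dbn] := ltP 0 (D b); first by rewrite expr1 mulN1r opprK pmulr_lge0.
by rewrite expr0 mul1r oppr_ge0 nmulr_lge0 // lt_neqAle b0.
Qed.

(** For [x1 <= x2], the difference [f2 - f1] with sign [s] is nonnegative at [x1], where [f1] meets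
    [fd], and nonpositive at [x2], where [f2] does; the intermediate value theorem gives a zero. *)
Lemma two_supports_meet {R : realType} (s : bool) (J1 J2 Jd : set R)
    (f1 f2 fd : R -> R) (x1 x2 : R) :
  segment_continuous J1 f1 -> segment_continuous J2 f2 ->
  (forall y, Num.min x1 x2 <= y <= Num.max x1 x2 -> J1 y /\ J2 y) ->
  touches_from s J1 f1 Jd fd x1 -> touches_from s J2 f2 Jd fd x2 ->
  exists y, [/\ J1 y, J2 y & f1 y = f2 y].
Proof.
wlog x12 : J1 J2 f1 f2 x1 x2 / x1 <= x2.
  move=> W c1 c2 H t1 t2; have [x12|/ltW x21] := leP x1 x2; first exact: (W _ _ _ _ x1 x2).
  have [|y [? ? ?]] := W J2 J1 f2 f1 x2 x1 x21 c2 c1 _ t2 t1.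
    by move=> y; rewrite minC maxC => /H[].
  by exists y.
rewrite (min_idPl x12) (max_idPr x12) => c1 c2 H.
move=> [_ Jd1 e1 h1] [_ Jd2 e2 h2].
have [J11 J21] := H x1 (introT andP (conj (lexx _) x12)).
have [J12 J22] := H x2 (introT andP (conj x12 (lexx _))).
have [F1 cF1 F1E] := c1 x1 x2 J11 J12 x12.
have [F2 cF2 F2E] := c2 x1 x2 J21 J22 x12.
pose G y := (-1) ^+ s * (F2 y - F1 y).
have cG : continuous G.
  by move=> y; apply: cvgM; [exact: cvg_cst|apply: cvgB; [exact: cF2|exact: cF1]].
have I1 : x1 \in `[x1, x2] by rewrite in_itv /= lexx.
have I2 : x2 \in `[x1, x2] by rewrite in_itv /= lexx andbT.
have G1 : 0 <= G x1 by rewrite /G F1E // F2E // e1; exact: h2.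
have G2 : G x2 <= 0.
  by rewrite /G F1E // F2E // e2 -opprB mulrN oppr_le0; exact: h1.
have [|y yI] := @IVT _ G x1 x2 0 x12 (continuous_subspaceT cG).
  by rewrite ge_min le_max G1 G2 orbT.
move/eqP; rewrite mulf_eq0 signr_eq0 subr_eq0 /= => /eqP e.
have [J1y J2y] := H y yI.
by exists y; split=> //; rewrite -F1E // -F2E.
Qed.

(** * Ranks of abscissae *)

(** Phrased through points of [J], so that open, closed and infinite ends need no case
    distinction. *)
Definition starts_by {R : realType} (J : set R) (y : R) : bool :=
  `[< exists2 z, J z & z <= y >].

Definition ends_before {R : realType} (J : set R) (y : R) : bool :=
  `[< forall z, J z -> z < y >].

Lemma starts_by_mono {R : realType} (J : set R) y y' :
  y <= y' -> (starts_by J y <= starts_by J y')%N.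
Proof.
rewrite /starts_by => yy'; case: asboolP => // -[z Jz zy]; rewrite asboolT //.
by exists z => //; exact: le_trans yy'.
Qed.

Lemma ends_before_mono {R : realType} (J : set R) y y' :
  y <= y' -> (ends_before J y <= ends_before J y')%N.
Proof.
rewrite /ends_before => yy'; case: asboolP => // H; rewrite asboolT // => z /H zy.
exact: lt_le_trans yy'.
Qed.

Lemma interval_memE {R : realType} (J : set R) y : is_interval J ->
  J y <-> starts_by J y && ~~ ends_before J y.
Proof.
move=> itv; split=> [Jy|].
  rewrite /starts_by asboolT /=; last by exists y.
  by apply/asboolPn => /(_ _ Jy); rewrite ltxx.
move=> /andP[/asboolP[z Jz zy] /asboolPn /existsNP[z' /not_implyP[Jz']]].
by move=> /negP; rewrite -leNgt => yz'; apply: (itv z z') => //; rewrite zy.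
Qed.

(* Points of equal rank lie in the same intervals [J c], whatever the
   openness of the endpoints. *)
Definition rank {R : realType} {n : nat} (J : 'I_n -> set R) (y : R) : nat :=
  (\sum_(c < n) (starts_by (J c) y + ends_before (J c) y))%N.

Lemma rank_mono {R : realType} n (J : 'I_n -> set R) y y' :
  y <= y' -> (rank J y <= rank J y')%N.
Proof.
move=> yy'; apply: leq_sum => c _.
by apply: leq_add; [exact: starts_by_mono|exact: ends_before_mono].
Qed.

Lemma rank_le {R : realType} n (J : 'I_n -> set R) y : (rank J y <= n.*2)%N.
Proof.
rewrite -muln2 -[X in (_ <= X * _)%N]card_ord -sum_nat_const.
by apply: leq_sum => c _; exact: leq_add (leq_b1 _) (leq_b1 _).
Qed.

(** The rank sums indicators that are nondecreasing in [y]; equal sums force each to agree, and the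
    two of [c] determine membership in [J c]. *)
Lemma rank_mem {R : realType} n (J : 'I_n -> set R) c y y' :
  is_interval (J c) -> rank J y = rank J y' -> J c y -> J c y'.
Proof.
move=> itv; rewrite (interval_memE _ _ itv) (interval_memE _ y' itv).
have AB x x' : x <= x' -> rank J x = rank J x' ->
    starts_by (J c) x = starts_by (J c) x' /\ ends_before (J c) x = ends_before (J c) x'.
  move=> xx' e.
  have rest : (\sum_(c' < n | c' != c) (starts_by (J c') x + ends_before (J c') x) <=
      \sum_(c' < n | c' != c) (starts_by (J c') x' + ends_before (J c') x'))%N.
    apply: leq_sum => c' _.
    by apply: leq_add; [exact: starts_by_mono|exact: ends_before_mono].
  move: e rest (starts_by_mono (J c) _ _ xx') (ends_before_mono (J c) _ _ xx').
  rewrite /rank (bigD1 c) //= [in RHS](bigD1 c) //=.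
  have arith (a b a' b' : bool) (S S' : nat) : (a + b + S = a' + b' + S')%N ->
      (S <= S')%N -> (a <= a')%N -> (b <= b')%N -> a = a' /\ b = b'.
    by case: a; case: b; case: a'; case: b' => //=; lia.
  exact: arith.
move=> e; have [yy'|/ltW y'y] := leP y y'.
  by have [-> ->] := AB _ _ yy' e.
by have [-> ->] := AB _ _ y'y (esym e).
Qed.

(** * Dyadic cells of ranks *)

Definition same_cell {R : realType} {n : nat} (J : 'I_n -> set R) (k : nat) (x y : R) :=
  (rank J x %/ 2 ^ k)%N = (rank J y %/ 2 ^ k)%N.

Lemma same_cell_between {R : realType} n (J : 'I_n -> set R) k x y z :
  same_cell J k x y -> Num.min x y <= z <= Num.max x y -> same_cell J k z x.
Proof.
wlog xy : x y / x <= y.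
  move=> W; have [xy|/ltW yx] := leP x y.
    by move=> /(W _ _ xy); rewrite (min_idPl xy) (max_idPr xy).
  move=> xEy H; rewrite /same_cell xEy; apply: (W y x yx (esym xEy)).
  by rewrite (min_idPl yx) (max_idPr yx).
rewrite (min_idPl xy) (max_idPr xy) /same_cell => e /andP[xz zy].
apply/eqP; rewrite eqn_leq {1}e !leq_div2r ?rank_mono //.
Qed.

Definition long {R : realType} {n : nat} (J : 'I_n -> set R) (k : nat) (c : 'I_n) (x : R) :=
  forall y, same_cell J k x y -> J c y.

Lemma long0 {R : realType} n (J : 'I_n -> set R) c x :
  is_interval (J c) -> J c x -> long J 0 c x.
Proof. by move=> itv Jx y; rewrite /same_cell !divn1 => e; exact: rank_mem itv e Jx. Qed.

Definition exits_left {R : realType} {n : nat} (J : 'I_n -> set R) (k : nat)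
    (c : 'I_n) (x : R) :=
  exists y, [/\ y < x, ~ J c y & same_cell J k x y].

(** An interval has one left and one right end. If both points have an exit on the left, that of the
    larger point lies below the smaller one; if neither has, the exit of the smaller point lies
    beyond the larger one. Either way the cell of one point contains the other. *)
Lemma short_same_cell {R : realType} n (J : 'I_n -> set R) k c x x' :
  is_interval (J c) -> J c x -> J c x' -> ~ long J k c x -> ~ long J k c x' ->
  (exits_left J k c x <-> exits_left J k c x') -> same_cell J k x x'.
Proof.
wlog xx' : x x' / x <= x'.
  move=> W itv Jx Jx' sx sx' e; have [|/ltW] := leP x x' => h; first exact: W.
  exact: esym (W x' x h itv Jx' Jx sx' sx (iff_sym e)).
move=> itv Jx Jx' sx sx' E.
have [L|nL] := pselect (exits_left J k c x).
  have [y [yx' nJy e]] := E.1 L.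
  have yx : y < x.
    by rewrite ltNge; apply/negP => xy; apply: nJy; apply: (itv x x'); rewrite // xy ltW.
  apply: (same_cell_between _ _ _ _ _ _ e).
  by rewrite (min_idPr (ltW yx')) (max_idPl (ltW yx')) (ltW yx).
have /existsNP[y /not_implyP[e nJy]] := sx.
have xy : x' < y.
  rewrite ltNge; apply/negP => yx'; have [yx|xy] := ltP y x.
    by apply: nL; exists y.
  by apply: nJy; apply: (itv x x'); rewrite // xy.
apply: esym; apply: (same_cell_between _ _ _ _ _ _ e).
have xy' := le_trans xx' (ltW xy).
by rewrite (min_idPl xy') (max_idPr xy') xx' ltW.
Qed.

(** * Charging tangencies to labels *)

(* The pair [ij] consists of [d] and a curve [c] touching it; [k] is the
   largest scale at which one of the two covers the whole cell of the touching
   point. *)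
Definition charged {R : realType} {n : nat} (J : 'I_n -> set R) (f : 'I_n -> R -> R)
    (K : nat) (ij : 'I_n * 'I_n) (l : 'I_n * 'I_K.+1 * (bool * bool * bool)) : Prop :=
  let: (d, k, (s, e, b)) := l in
  exists c x, [/\ ij = (c, d) \/ ij = (d, c),
    touches_from s (J c) (f c) (J d) (f d) x,
    long J k c x,
    (k < K)%N -> ~ long J k.+1 d x &
    e = `[< exits_left J k.+1 d x >] /\ b = odd (rank J x %/ 2 ^ k)%N].

(** Scale [0] qualifies, its cells being single ranks, so a largest [k] exists. A curve covering the
    cell becomes [c], the other [d]; exchanging the two curves reverses the side. *)
Lemma charged_exists {R : realType} n (J : 'I_n -> set R) (f : 'I_n -> R -> R) K
    (ij : 'I_n * 'I_n) s x :
  (forall c, is_interval (J c)) ->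
  touches_from s (J ij.1) (f ij.1) (J ij.2) (f ij.2) x ->
  exists l, @charged R n J f K ij l.
Proof.
case: ij => i j /= itv t.
pose P (k : 'I_K.+1) := `[< long J k i x \/ long J k j x >].
have P0 : P ord0.
  by apply/asboolP; left; apply: long0 => //; case: t.
have [k /asboolP Pk kmax] := arg_maxnP (fun k : 'I_K.+1 => val k) P0.
have short c : c = i \/ c = j -> (k < K)%N -> ~ long J k.+1 c x.
  move=> cij kK lc; have kK1 : (k.+1 < K.+1)%N by [].
  have := kmax (Ordinal kK1); rewrite /= ltnn => H.
  by apply: notF; apply: H; apply/asboolP; case: cij lc => ->; [left|right].
case: Pk => lk.
  exists (j, k, (s, `[< exits_left J k.+1 j x >], odd (rank J x %/ 2 ^ k)%N)).
  by exists i, x; split=> //; [left|apply: short; right].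
exists (i, k, (~~ s, `[< exits_left J k.+1 i x >], odd (rank J x %/ 2 ^ k)%N)).
by exists j, x; split=> //; [right|exact: touches_from_sym|apply: short; left].
Qed.

(** The label fixes the cell of the tangency: below the top scale, [d], [k] and [e] fix the cell of
    scale [k.+1], and [b] its half. Both [c] and [c'] cover that cell, have the colour opposite to
    [d] and touch [d] from the same side; if distinct, they would meet. *)
Lemma charged_inj {R : realType} n (J : 'I_n -> set R) (f : 'I_n -> R -> R)
    (red : 'I_n -> bool) K (ij ij' : 'I_n * 'I_n) l :
  (n.*2 < 2 ^ K)%N ->
  (forall c, is_interval (J c)) -> (forall c, segment_continuous (J c) (f c)) ->
  (forall c d x, c != d -> red c = red d -> J c x -> J d x -> f c x <> f d x) ->
  (ij.1 < ij.2)%N -> (ij'.1 < ij'.2)%N ->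
  @charged R n J f K ij l -> @charged R n J f K ij' l -> ij = ij'.
Proof.
case: l => [[d k] [[s e] b]] nK itv cf disj lt lt' [c [x [cd t lc sd [eE bE]]]].
move=> [c' [x' [cd' t' lc' sd' [eE' bE']]]].
have nc : c != d by case: cd lt => -> /=; rewrite neq_ltn => ->; rewrite ?orbT.
have nc' : c' != d by case: cd' lt' => -> /=; rewrite neq_ltn => ->; rewrite ?orbT.
have [Jcx Jdx fx _] := t; have [Jcx' Jdx' fx' _] := t'.
have rk y : (rank J y %/ 2 ^ K = 0)%N.
  by rewrite divn_small // (leq_ltn_trans (rank_le _ _ _)).
have cell : same_cell J k x x'.
  have [kK|Kk] := ltnP k K; last first.
    have -> : k = K :> nat by apply/eqP; rewrite eqn_leq Kk -ltnS ltn_ord.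
    by rewrite /same_cell !rk.
  have : same_cell J k.+1 x x'.
    apply: (short_same_cell _ _ _ d) => //; [exact: sd|exact: sd'|].
    by apply: asbool_eq_equiv; rewrite -eE -eE'.
  (* The quotient at scale [k] is twice the one at scale [k.+1] plus its parity [b]. *)
  rewrite /same_cell expnSr !divnMA !divn2 => h.
  by rewrite -(odd_double_half (_ %/ _)) h -bE bE' odd_double_half.
have cc' : c = c'.
  apply/eqP; apply: contraT => ncc'.
  have rcc' : red c = red c'.
    have rc : red c != red d by apply/eqP => /(disj c d x nc) /(_ Jcx Jdx fx).
    have rc' : red c' != red d by apply/eqP => /(disj c' d x' nc') /(_ Jcx' Jdx' fx').
    by case: (red c) (red c') (red d) rc rc' => [] [] [].
  have [|y [Jcy Jcy' fy]] := two_supports_meet s (J c) (J c') (J d) (f c) (f c') (f d) x x'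
    (cf c) (cf c') _ t t'.
    move=> y ybt; have yx := same_cell_between _ _ _ _ _ _ cell ybt.
    by split; [exact/lc/esym|apply: lc'; rewrite /same_cell -cell; exact: esym].
  by case: (disj c c' y ncc' rcc' Jcy Jcy' fy).
by move: cd cd' lt lt'; rewrite -cc' => -[] -> -[] -> //= h h';
  have := ltn_trans h h'; rewrite ltnn.
Qed.

(** * Counting labels and the logarithmic bound *)

(** Pairs inject into labels: [n] curves, [K.+1] scales and [8] triples of bits. *)
Lemma card_touching_pairs {R : realType} n (J : 'I_n -> set R) (f : 'I_n -> R -> R)
    (red : 'I_n -> bool) K (A : {set 'I_n * 'I_n}) :
  (n.*2 < 2 ^ K)%N ->
  (forall c, is_interval (J c)) -> (forall c, segment_continuous (J c) (f c)) ->
  (forall c d x, c != d -> red c = red d -> J c x -> J d x -> f c x <> f d x) ->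
  (forall ij, ij \in A -> (ij.1 < ij.2)%N /\
     exists s x, touches_from s (J ij.1) (f ij.1) (J ij.2) (f ij.2) x) ->
  (#|A| <= n * K.+1 * 8)%N.
Proof.
move=> nK itv cf disj AP.
have [->|[ij0 Aij0]] := set_0Vmem A; first by rewrite cards0.
(* Default label for pairs outside [A]. *)
have l0 : 'I_n * 'I_K.+1 * (bool * bool * bool) := (ij0.1, ord0, (true, true, true)).
have /choice[L LP] : forall ij, exists l, ij \in A -> @charged R n J f K ij l.
  move=> ij; have [ijA|nA] := boolP (ij \in A); last by exists l0.
  have [_ [s [x t]]] := AP ij ijA.
  by have [l lP] := charged_exists _ _ _ K ij s x itv t; exists l.
have Linj : {in A &, injective L}.
  move=> ij ij' ijA ijA' e.
  apply: (charged_inj _ J f red K ij ij' (L ij)) => //.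
  - by have [] := AP ij ijA.
  - by have [] := AP ij' ijA'.
  - exact: LP.
  - by rewrite e; exact: LP.
rewrite -(card_in_imset Linj) (leq_trans (max_card _)) //.
by rewrite !card_prod !card_ord !card_bool.
Qed.

(** With [t] the truncated logarithm, [2 ^ t <= 2 * n] gives [t * ln 2 <= ln 2 + ln n], so [(t + 2)
    * ln 2 <= 3 * ln 2 + ln n <= 4 * ln n]. *)
Lemma trunc_log2_le_ln {R : realType} (n : nat) : (2 <= n)%N ->
  ((trunc_log 2 n.*2).+2%:R : R) <= 4 / ln 2 * ln n%:R.
Proof.
move=> n2; have ln2 : 0 < ln (2 : R) by rewrite ln_gt0 // ltr1n.
have n0 : (0 < n)%N by exact: ltn_trans n2.
have lnn : ln (2 : R) <= ln n%:R by rewrite ler_ln ?posrE ?ltr0n // ler_nat.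
have : ln (2 : R) *+ trunc_log 2 n.*2 <= ln 2 + ln n%:R.
  rewrite -lnXn // -lnM ?posrE ?ltr0n // ler_ln ?posrE ?exprn_gt0 ?mulr_gt0 ?ltr0n //.
  by rewrite -natrX -natrM ler_nat mul2n trunc_logP // double_gt0.
rewrite -[X in X <= _]mulr_natl => h.
rewrite mulrAC ler_pdivlMr // -addn2 natrD mulrDl; lra.
Qed.

Theorem theorem1 (R : realType) :
  exists C : R, 0 < C /\
  forall (n : nat), (2 <= n)%N ->
  forall (I : 'I_n -> set R) (g : 'I_n -> R -> (R * R)%type) (red : 'I_n -> bool),
    curve_family I g ->
    (forall i, x_monotone (curve_set (I i) (g i))) ->
    (forall i j, i != j -> red i = red j ->
       curve_set (I i) (g i) `&` curve_set (I j) (g j) = set0) ->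
    (num_tangencies I g)%:R <= C * n%:R * ln (n%:R : R).
Proof.
have ln2 : 0 < ln (2 : R) by rewrite ln_gt0 // ltr1n.
(* [32 = 8 * 4]: eight triples of bits, and at most [4 / ln 2 * ln n] scales. *)
exists (32 / ln 2); split; first by rewrite divr_gt0.
move=> n n2 I g red [curves _] mono disj.
have /choice[J /choice[f graphP]] := fun i => x_monotone_graph _ _ (curves i) (mono i).
(* The least [K] with [n.*2 < 2 ^ K]. *)
pose K := (trunc_log 2 n.*2).+1.
have cardA : (num_tangencies I g <= n * K.+1 * 8)%N.
  rewrite /num_tangencies -cardsE; apply: (card_touching_pairs _ J f red) => //.
  - exact: trunc_log_ltn.
  - by move=> c; have [] := graphP c.
  - by move=> c; have [] := graphP c.
  - move=> c d x cd rcd Jc Jd fcd; have := disj c d cd rcd.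
    have [_ _ -> _] := graphP c; have [_ _ -> _] := graphP d.
    by apply/eqP/set0P; exists (x, f c x).
  move=> [i j]; rewrite finset.inE in_setE /= => /andP[ij /asboolP[p tp]]; split=> //.
  have [itvi ci gi ri] := graphP i; have [itvj cj gj rj] := graphP j.
  have [s t] := touch_at_touches_from _ _ _ _ _ _ _ _ p itvi ci itvj cj gi gj (ri p) (rj p) tp.
  by exists s, p.1.
rewrite (le_trans (_ : _ <= (n * K.+1 * 8)%:R)) ?ler_nat // !natrM.
have := trunc_log2_le_ln n n2; rewrite -/K => h.
have -> : 32 / ln 2 * n%:R * ln n%:R = n%:R * (4 / ln 2 * ln n%:R) * 8%:R :> R by ring.
rewrite ler_pM2r //; apply: ler_wpM2l => //; exact: h.
Qed.
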